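(* Let $M,L>0$ and suppose that every cost function $f_t:[0,1]\to[0,\infty)$, $1\le t\le T$, is convex, $M$-smooth, $L$-Lipschitz and satisfies $\min_{x\in[0,1]}f_t(x)=0$. In the stale gradient setting, run the algorithm A-OBD$(\tilde\delta)$ with constant parameter $$\tilde\delta=\frac{\sqrt{(M+2L-2)^2+8(M+4L+4)}}{4}-\frac{M+2L-2}{4}.$$ Then its competitive ratio satisfies $$\mu_{\text{A-OBD}(\tilde\delta)}\le\frac{M+2L+6}{4}+\frac{\sqrt{(M+2L-2)^2+8(M+4L+4)}}{4},$$ and in particular it is $O(M+L)$ (as $M+L\to\infty$).
   Context: Problem (online convex optimization with linear switching cost, dimension one). An input $\sigma$ consists of a horizon $T$, a starting point $x_0\in[0,1]$ and cost functions $f_1,\dots,f_T:[0,1]\to[0,\infty)$. Choosing actions $x_1,\dots,x_T\in[0,1]$ costs $\sum_{t=1}^T\big(f_t(x_t)+|x_t-x_{t-1}|\big)$. $C_{\mathcal A}(\sigma)$ is the cost of the online algorithm $\mathcal A$ on $\sigma$, and $C_{OPT}(\sigma)$ is the minimum of the cost over all action sequences in $[0,1]$ with the same starting point $x_0$ (the whole input being known in advance). The competitive ratio is $\mu_{\mathcal A}=\max_\sigma C_{\mathcal A}(\sigma)/C_{OPT}(\sigma)$, over all inputs satisfying the stated assumptions; $\mu_{\mathcal A}\le c$ means $C_{\mathcal A}(\sigma)\le c\,C_{OPT}(\sigma)$ for every such $\sigma$. Smoothness: $f$ is $M$-smooth if it is differentiable on $[0,1]$ (one-sidedly at the endpoints)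 with $M$-Lipschitz derivative $\nabla f$. Stale gradient setting: to choose $x_t$ the algorithm may use only $\{f_{i-1}(x_{i-1}),\nabla f_{i-1}(x_{i-1}) : i=2,\dots,t\}$. Algorithm A-OBD$(\delta)$, $\delta>0$, in the stale gradient setting: $x_1=x_0$ (no information is available at time $1$); at each time $t\ge2$, let $L_1(x)=f_{t-1}(x_{t-1})+\nabla f_{t-1}(x_{t-1})(x-x_{t-1})$ and $L_2(x)=\delta\cdot\operatorname{sign}(-\nabla f_{t-1}(x_{t-1}))\,(x-x_{t-1})$, and let $x_t$ be the point with $L_1(x_t)=L_2(x_t)$. (If $\nabla f_{t-1}(x_{t-1})=0$, then $f_{t-1}(x_{t-1})=0$ and $x_t=x_{t-1}$.) *)

(* Defs.v *)
From HB Require Import structures.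
From mathcomp Require Import all_boot all_order all_algebra.
From mathcomp Require Import all_classical all_reals all_analysis.

Set Implicit Arguments.
Unset Strict Implicit.
Unset Printing Implicit Defensive.

Import Order.TTheory GRing.Theory Num.Theory numFieldNormedType.Exports.

Local Open Scope classical_set_scope.
Local Open Scope ring_scope.

Definition action_set {R : realType} : set R := `[0, 1]%classic.

(* Derivatives relative to [0,1]: increments are restricted to points of [0,1],
   so that the derivatives at 0 and 1 are the one-sided ones.  Cost functions
   have type R -> R, but only their values on [0,1] are ever constrained. *)
Definition diff_quot {R : realType} (f : R -> R) (x y : R) : R :=
  (f y - f x) / (y - x).

Definition differentiable01 {R : realType} (f : R -> R) (x : R) : Prop :=
  cvg (diff_quot f x y @[y --> within action_set x^']).

Definition grad {R : realType} (f : R -> R) (x : R) : R :=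
  lim (diff_quot f x y @[y --> within action_set x^']).

Definition smooth {R : realType} (M : R) (f : R -> R) : Prop :=
  (forall x, action_set x -> differentiable01 f x) /\
  M.-lipschitz_(action_set) (grad f).

Definition min_is_zero {R : realType} (f : R -> R) : Prop :=
  (exists2 x, action_set x & f x = 0) /\ (forall x, action_set x -> 0 <= f x).

Definition admissible_cost {R : realType} (M L : R) (f : R -> R) : Prop :=
  [/\ convex_function (action_set : set R^o) f,
      smooth M f,
      L.-lipschitz_(action_set) f &
      min_is_zero f].

(* Times are numbered from 1: only [cost s t] for 1 <= t <= [horizon s] is
   meaningful. *)
Record input (R : realType) := Input {
  horizon : nat;
  start : R;
  cost : nat -> R -> R }.

Definition admissible {R : realType} (M L : R) (s : input R) : Prop :=
  action_set (start s) /\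
  forall t, (1 <= t <= horizon s)%N -> admissible_cost M L (cost s t).

Definition total_cost {R : realType} (s : input R) (x : nat -> R) : R :=
  \sum_(1 <= t < (horizon s).+1) (cost s t (x t) + `|x t - x t.-1|).

Definition feasible {R : realType} (s : input R) (x : nat -> R) : Prop :=
  x 0%N = start s /\
  forall t, (1 <= t <= horizon s)%N -> action_set (x t).

(* The infimum is a minimum on admissible inputs, by compactness. *)
Definition opt_cost {R : realType} (s : input R) : R :=
  inf [set total_cost s x | x in feasible s].

(* A deterministic online algorithm in the stale gradient setting: x_t is a
   function of x_0 and of the chronological list of the pairs
   (f_i(x_i), grad f_i(x_i)), 1 <= i <= t-1.  Its own past actions need not be
   listed, since the algorithm can recompute them from these data. *)
Definition stale_algorithm (R : realType) := R -> seq (R * R) -> R.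

Fixpoint feedback {R : realType} (A : stale_algorithm R) (s : input R)
    (t : nat) : seq (R * R) :=
  if t is t'.+1 then
    let h := feedback A s t' in
    let x := A (start s) h in
    rcons h (cost s t x, grad (cost s t) x)
  else [::].

Definition run {R : realType} (A : stale_algorithm R) (s : input R)
    (t : nat) : R :=
  if t is t'.+1 then A (start s) (feedback A s t') else start s.

Definition alg_cost {R : realType} (A : stale_algorithm R) (s : input R) : R :=
  total_cost s (run A s).

(* "The competitive ratio of A over the inputs in S is at most c", in
   multiplicative form so that inputs of zero optimal cost are covered. *)
Definition competitive_ratio_le {R : realType} (A : stale_algorithm R)
    (S : set (input R)) (c : R) : Prop :=
  forall s, S s -> alg_cost A s <= c * opt_cost s.

(* The update of A-OBD from the previous action [y], with [v] = f(y) and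
   [g] = grad f (y).  If delta > 0 and [g] is nonzero, the lines have different
   slopes, so the point chosen by [xget] exists and is unique. *)
Definition aobd_L1 {R : realType} (y v g x : R) : R := v + g * (x - y).

Definition aobd_L2 {R : realType} (delta y g x : R) : R :=
  delta * Num.sg (- g) * (x - y).

Definition aobd_step {R : realType} (delta y v g : R) : R :=
  if g == 0 then y
  else xget y [set x | aobd_L1 y v g x = aobd_L2 delta y g x].

(* In particular the first action (empty history) is x_1 = x_0. *)
Definition aobd {R : realType} (delta : R) : stale_algorithm R :=
  fun x0 h => foldl (fun y vg => aobd_step delta y vg.1 vg.2) x0 h.

Definition root_term {R : realType} (M L : R) : R :=
  Num.sqrt ((M + 2 * L - 2) ^+ 2 + 8 * (M + 4 * L + 4)).

Definition delta_tilde {R : realType} (M L : R) : R :=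
  root_term M L / 4 - (M + 2 * L - 2) / 4.

(* Main.v *)
(* Writing [p] for a comparison sequence and [d t] for the length of the move
   from [x t] to [x t.+1], the quantity [c * |x t.+1 - p t|] is a potential
   function: since [f t] lies above its tangent [L_1] at [x t], and [L_1] is at
   least [delta * d t] on the near side of [x t.+1], either the move approaches
   [p t] and pays for itself, or [f t (p t)] is already comparable to
   [f t (x t)] and [d t].  This needs only [1 + delta + L <= c] and
   [c + 1 <= (c - 1) * delta], which follow from
   [2 delta^2 + (M + 2 L - 2) delta = M + 4 L + 4]. *)
Require Import Defs.
From HB Require Import structures.
From mathcomp Require Import all_boot all_order all_algebra.
From mathcomp Require Import all_classical all_reals all_analysis.
From mathcomp Require Import ring lra.

Set Implicit Arguments.
Unset Strict Implicit.

Import Order.TTheory GRing.Theory Num.Theory numFieldNormedType.Exports.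

Local Open Scope classical_set_scope.
Local Open Scope ring_scope.

(** * Tangents of convex functions on the unit interval *)

Lemma action_setE (R : realType) (x : R) : action_set x <-> 0 <= x <= 1.
Proof. by rewrite /action_set /= in_itv. Qed.

Lemma convex_chord (R : realType) (f : R -> R) (x z t : R) :
  convex_function (action_set : set R^o) f ->
  action_set x -> action_set z -> 0 <= t <= 1 ->
  f (x + t * (z - x)) <= f x + t * (f z - f x).
Proof.
move=> cf x01 z01 /andP[t0 t1].
have : f (t * z + (1 - t) * x) <= t * f z + (1 - t) * f x.
  exact: (cf (Itv01 t0 t1) z x (mem_set z01) (mem_set x01)).
rewrite (_ : t * z + _ = x + t * (z - x)); last by ring.
lra.
Qed.

Lemma lipschitz_action_set (R : realType) (L : R) (f : R -> R) (x y : R) :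
  L.-lipschitz_(action_set) f -> action_set x -> action_set y ->
  `|f x - f y| <= L * `|x - y|.
Proof. by move=> Lf x01 y01; exact: (Lf (x, y)). Qed.

(** Segments between points of the interval stay in it, so the relative limit defining [grad] can be
    tested along any of them, at the endpoints as well as inside. *)
Lemma grad_approx (R : realType) (f : R -> R) (x z e : R) :
  differentiable01 f x -> action_set x -> action_set z -> z != x -> 0 < e ->
  exists2 t, 0 < t <= 1 &
    `|grad f x - diff_quot f x (x + t * (z - x))| < e.
Proof.
move=> df x01 z01 zx e0.
have := df; rewrite /differentiable01 => /cvgrPdist_lt /(_ e e0).
rewrite near_withinE => /nbhs_ballP[r /= r0 rP].
have zx0 : 0 < `|z - x| by rewrite normr_gt0 subr_eq0.
(* The cap 1 keeps the point on the segment; the other bound keeps it within [r / 2] of [x]. *)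
pose t := Num.min 1 (r / 2 / `|z - x|).
have t0 : 0 < t by rewrite lt_min ltr01 !divr_gt0.
have t1 : t <= 1 by rewrite ge_min lexx.
exists t; first by rewrite t0 t1.
apply: rP => /=.
- rewrite /ball /= opprD addrA subrr sub0r normrN normrM gtr0_norm //.
  apply: (@le_lt_trans _ _ (r / 2)); last by lra.
  by rewrite -ler_pdivlMr // ge_min lexx orbT.
- by rewrite -subr_eq0 (addrC x) addrK mulf_neq0 ?subr_eq0 ?(gt_eqF t0).
- move: x01 z01; rewrite !action_setE => x01 z01; nra.
Qed.

(** By the chord inequality, a quotient towards [z] times [z - x] is at most [f z - f x]; replacing
    the quotient by [grad f x] costs at most [e]. *)
Lemma tangent_le (R : realType) (f : R -> R) (x z : R) :
  convex_function (action_set : set R^o) f -> differentiable01 f x ->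
  action_set x -> action_set z -> f x + grad f x * (z - x) <= f z.
Proof.
move=> cf df x01 z01.
have [->|zx] := eqVneq z x; first by rewrite subrr mulr0 addr0.
apply/ler_addgt0Pr => e e0.
have zx0 : 0 < `|z - x| by rewrite normr_gt0 subr_eq0.
have [t /andP[t0 t1]] := grad_approx df x01 z01 zx (divr_gt0 e0 zx0).
set y := x + _; set q := diff_quot f x y => gq.
have yx : y - x = t * (z - x) by rewrite /y; ring.
have qE : q * (t * (z - x)) = f y - f x.
  by rewrite -yx /q /diff_quot divfK // yx mulf_neq0 ?subr_eq0 ?(gt_eqF t0).
have := @convex_chord _ f x z t cf x01 z01; rewrite ltW //= t1 => /(_ isT) fy.
have qz : q * (z - x) <= f z - f x.
  by rewrite -(ler_pM2l t0); rewrite -/y in fy; lra.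
have : (grad f x - q) * (z - x) <= e.
  apply: le_trans (ler_norm _) _; rewrite normrM -ler_pdivlMr //; exact: ltW.
lra.
Qed.

Lemma grad_norm_le (R : realType) (L : R) (f : R -> R) (x : R) :
  L.-lipschitz_(action_set) f -> differentiable01 f x -> action_set x ->
  `|grad f x| <= L.
Proof.
move=> Lf df x01.
have [z z01 zx] : exists2 z : R, action_set z & z != x.
  have [->|x0] := eqVneq x 0.
    by exists 1; [rewrite action_setE ler01 lexx|exact: oner_neq0].
  by exists 0; [rewrite action_setE ler01 lexx|rewrite eq_sym].
apply/ler_addgt0Pr => e e0.
have [t /andP[t0 t1]] := grad_approx df x01 z01 zx e0.
set y := x + _ => gq.
have y01 : action_set y.
  by move: x01 z01; rewrite !action_setE /y => x01 z01; nra.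
have yx : 0 < `|y - x|.
  by rewrite normr_gt0 /y (addrC x) addrK mulf_neq0 ?subr_eq0 ?(gt_eqF t0).
have qL : `|diff_quot f x y| <= L.
  rewrite /diff_quot normrM normfV ler_pdivrMr //.
  exact: lipschitz_action_set.
have := ler_normD (grad f x - diff_quot f x y) (diff_quot f x y).
by rewrite subrK; lra.
Qed.

(** * Closed form of the update *)

Lemma aobd_stepE (R : realType) (delta y v g : R) : 0 < delta ->
  aobd_step delta y v g = y - Num.sg g * (v / (delta + `|g|)).
Proof.
move=> d0; rewrite /aobd_step; have [->|g0] := eqVneq g 0.
  by rewrite sgr0 mul0r subr0.
have dg : delta + `|g| != 0 by rewrite gt_eqF // ltr_wpDr.
have sgg : Num.sg g * Num.sg g = 1 by rewrite -expr2 sqr_sg g0.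
set x' := y - _.
have x'P : aobd_L1 y v g x' = aobd_L2 delta y g x'.
  rewrite /aobd_L1 /aobd_L2 sgrN /x' (addrC y) addrK.
  rewrite {1}[g]numEsg.
  transitivity (v - (Num.sg g * Num.sg g) * (`|g| * (v / (delta + `|g|)))).
    by ring.
  transitivity ((Num.sg g * Num.sg g) * (delta * (v / (delta + `|g|)))).
    by rewrite sgg !mul1r; field.
  by ring.
have := @xgetPex _ y [set x | aobd_L1 y v g x = aobd_L2 delta y g x]
  (ex_intro _ x' x'P).
set x := xget _ _ => /= xP.
apply/eqP; rewrite -subr_eq0.
(* Uniqueness of the intersection: [g] and [delta * sg g] have the same sign, so the two slopes
   differ. *)
have sdg : g + delta * Num.sg g != 0.
  by rewrite {1}[g]numEsg mulrC -mulrDl addrC mulf_neq0 // sgr_eq0.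
rewrite -(mulrI_eq0 _ (mulfI sdg)); apply/eqP.
by move: xP x'P; rewrite /aobd_L1 /aobd_L2 sgrN; lra.
Qed.

(** * A single update and its effect on the potential *)

Section AobdStep.
Variables (R : realType) (delta L c : R).
Hypotheses (delta_gt0 : 0 < delta) (c_ge : 1 + delta + L <= c)
  (c_delta : c + 1 <= (c - 1) * delta).

(** The tangent is at most 0 at a minimiser [z] and at least 0 at the new point, so the move does
    not pass [z]. *)
Lemma aobd_step_action_set (f : R -> R) (x : R) :
  convex_function (action_set : set R^o) f -> differentiable01 f x ->
  min_is_zero f -> action_set x ->
  action_set (aobd_step delta x (f x) (grad f x)).
Proof.
move=> cf df [[z z01 fz0] f_ge0] x01.
have := tangent_le cf df x01 z01; rewrite fz0.
have := f_ge0 _ x01; rewrite aobd_stepE //.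
move: (f x) (grad f x) x01 z01 => v g; rewrite !action_setE.
move=> x01 z01 v0 vz.
have dg : 0 < delta + `|g| by rewrite ltr_wpDr.
have := divfK (lt0r_neq0 dg) v; have := divr_ge0 v0 (ltW dg).
move: (v / _) => d d0 vE.
have [g0|g0|g0] := ltrgt0P g; move: vE vz.
- rewrite gtr0_sg // gtr0_norm // => vE vz.
  have : d <= x - z.
    rewrite -(ler_pM2l g0); have := mulr_ge0 (ltW delta_gt0) d0; lra.
  lra.
- rewrite ltr0_sg // ltr0_norm // => vE vz.
  have : d <= z - x.
    rewrite -oppr_gt0 in g0; rewrite -(ler_pM2l g0).
    have := mulr_ge0 (ltW delta_gt0) d0; lra.
  lra.
- by move=> _ _; rewrite g0 sgr0 mul0r subr0.
Qed.

Lemma potential_step_pos (y d g p w : R) :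
  0 < g -> g <= L -> 0 <= d -> 0 <= w -> (delta + g) * d + g * (p - y) <= w ->
  (delta + g) * d + d + c * `|y - d - p| <= c * (w + `|y - p|).
Proof.
move=> g0 gL d0 w0 wP.
have c1 : 1 <= c by move: c_ge delta_gt0; lra.
have cw := ler_wpM2l (le_trans ler01 c1) wP.
have cw0 : 0 <= c * w by rewrite mulr_ge0 // (le_trans ler01 c1).
have cg : 0 <= (c - 1) * g by rewrite mulr_ge0 ?subr_ge0 // ltW.
have toward : 0 <= c - 1 - delta - g by move: c_ge; lra.
have away : 0 <= (c - 1) * (delta + g) - (c + 1) by move: c_delta; lra.
have [py|py] := leP p (y - d).
  (* The whole move approaches [p]: the drop [c * d] of the potential pays for
     [(1 + delta + g) * d]. *)
  rewrite !ger0_norm; [|lra|lra].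
  have := mulr_ge0 toward d0; lra.
have [yp|yp] := leP y p.
  (* The move goes away from [p], but [w >= (delta + g) * d], so [c * w] also covers the growth
     [c * d] of the potential. *)
  rewrite !ler0_norm; [|lra|lra].
  have := mulr_ge0 away d0; have : 0 <= c * (g * (p - y)).
    by rewrite !mulr_ge0 ?subr_ge0 // ?ltW // (lt_le_trans ltr01 c1).
  lra.
rewrite ler0_norm ?gtr0_norm; [|lra|lra].
(* The inequality is affine in [p] on [y - d, y]: interpolate between the
   endpoints. *)
have at_x' : 0 <= (y - p) * (c - 1 - delta - g).
  by rewrite mulr_ge0 // subr_ge0 ltW.
have at_x'_slack : 0 <= (y - p) * (c * delta).
  by rewrite !mulr_ge0 ?subr_ge0 // ?ltW // (lt_le_trans ltr01 c1).
have at_y : 0 <= (p - (y - d)) * ((c - 1) * (delta + g) - (c + 1)).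
  by rewrite mulr_ge0 // subr_ge0 ltW.
lra.
Qed.

Lemma potential_step (y v g p w : R) (x' := aobd_step delta y v g) :
  0 <= v -> `|g| <= L -> 0 <= w -> v + g * (p - y) <= w ->
  v + `|x' - y| + c * `|x' - p| <= c * (w + `|y - p|).
Proof.
rewrite {}/x' aobd_stepE // => v0 gL w0 wP.
have dg : 0 < delta + `|g| by rewrite ltr_wpDr.
have := divfK (lt0r_neq0 dg) v; have := divr_ge0 v0 (ltW dg).
move: (v / _) => d d0; rewrite [d * _]mulrC => vE.
have [g0|g0|g0] := ltrgt0P g; move: vE gL.
- rewrite gtr0_sg // gtr0_norm // mul1r => vE gL.
  rewrite (addrC y) addrK normrN ger0_norm // (addrC _ y) -vE.
  by apply: potential_step_pos => //; rewrite vE.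
- rewrite ltr0_sg // ltr0_norm // mulN1r opprK => vE gL.
  rewrite [y + d]addrC addrK ger0_norm // -vE.
  (* Reflecting the line through 0 reduces [g < 0] to the positive case. *)
  rewrite -[`|_ - p|]normrN -[`|y - p|]normrN.
  rewrite (_ : - (d + y - p) = - y - d - - p); last by ring.
  rewrite (_ : - (y - p) = - y - - p); last by ring.
  apply: potential_step_pos => //; first by rewrite oppr_gt0.
  by rewrite vE; lra.
- rewrite g0 sgr0 mul0r subr0 subrr normr0 addr0 => _ L0.
  have c1 : 1 <= c by move: c_ge delta_gt0; lra.
  rewrite g0 mul0r addr0 in wP.
  have : w <= c * w by rewrite ler_peMl.
  lra.
Qed.

(** * Summing along a run *)

Lemma run_aobdSS (s : input R) (t : nat) (x := run (aobd delta) s t.+1) :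
  run (aobd delta) s t.+2 =
    aobd_step delta x (cost s t.+1 x) (grad (cost s t.+1) x).
Proof. by rewrite /x /= {1}/aobd foldl_rcons. Qed.

Lemma run_aobd_action_set (M : R) (s : input R) (t : nat) :
  admissible M L s -> (t <= horizon s)%N ->
  action_set (run (aobd delta) s t.+1).
Proof.
move=> [s01 adm]; elim: t => [//|t IH] tT.
have [cf [df _] _ minf] := adm t.+1 tT.
rewrite run_aobdSS; apply: aobd_step_action_set => //; last exact: IH (ltnW tT).
by apply: df; exact: IH (ltnW tT).
Qed.

(** Each cost is charged together with the move it triggers, which takes place one period later;
    hence the extra term for the move to [x n.+1]. *)
Lemma aobd_potential (M : R) (s : input R) (p : nat -> R)
    (x := run (aobd delta) s) :
  0 <= c -> admissible M L s -> feasible s p -> forall n, (n <= horizon s)%N ->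
  \sum_(1 <= t < n.+1) (cost s t (x t) + `|x t - x t.-1|) +
    `|x n.+1 - x n| + c * `|x n.+1 - p n|
  <= c * \sum_(1 <= t < n.+1) (cost s t (p t) + `|p t - p t.-1|).
Proof.
move=> c0 adm [p0 p01]; elim=> [_|n IH nT].
  (* Here [x 1 = x 0 = p 0], so move and potential both vanish. *)
  by rewrite !big_geq // /x /= p0 !subrr normr0 !mulr0 !addr0.
have recr (y : nat -> R) :
    \sum_(1 <= t < n.+2) (cost s t (y t) + `|y t - y t.-1|) =
    \sum_(1 <= t < n.+1) (cost s t (y t) + `|y t - y t.-1|) +
    (cost s n.+1 (y n.+1) + `|y n.+1 - y n|).
  by rewrite big_nat_recr.
rewrite !recr.
have x01 : action_set (x n.+1) := run_aobd_action_set adm (ltnW nT).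
have [cf [df _] Lf [_ f_ge0]] := (adm.2 n.+1 nT).
have p01n : action_set (p n.+1) := p01 n.+1 nT.
have := potential_step (f_ge0 _ x01)
  (grad_norm_le Lf (df _ x01) x01) (f_ge0 _ p01n)
  (tangent_le cf (df _ x01) x01 p01n).
rewrite -run_aobdSS -/x => step.
(* The movement of [p] raises the potential by no more than [c] times its own switching cost. *)
have tri : c * `|x n.+1 - p n.+1| <= c * (`|x n.+1 - p n| + `|p n.+1 - p n|).
  by apply: ler_wpM2l => //; rewrite [`|p _ - _|]distrC ler_distD.
have := IH (ltnW nT); lra.
Qed.

Lemma aobd_cost_le (M : R) (s : input R) (p : nat -> R) :
  0 <= c -> admissible M L s -> feasible s p ->
  alg_cost (aobd delta) s <= c * total_cost s p.
Proof.
move=> c0 adm feas; rewrite /alg_cost /total_cost.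
apply: le_trans (aobd_potential c0 adm feas (leqnn _)).
by rewrite -addrA lerDl addr_ge0 // mulr_ge0.
Qed.

End AobdStep.

(** * The optimal cost and the choice of the parameter *)

Lemma opt_cost_ge (R : realType) (s : input R) (b : R) :
  action_set (start s) ->
  (forall p, feasible s p -> b <= total_cost s p) -> b <= opt_cost s.
Proof.
move=> s01 bP; apply: lb_le_inf; last by move=> _ [p /bP ? <-].
by exists (total_cost s (fun=> start s)); exists (fun=> start s).
Qed.

Lemma opt_cost_ge0 (R : realType) (M L : R) (s : input R) :
  admissible M L s -> 0 <= opt_cost s.
Proof.
move=> [s01 adm]; apply: opt_cost_ge => // p [_ p01].
rewrite /total_cost big_nat_cond sumr_ge0 // => t /andP[tT _].
have [_ _ _ [_ f_ge0]] := adm t tT.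
by rewrite addr_ge0 // f_ge0 //; exact: p01.
Qed.

Lemma competitive_ratio_delta_tilde (R : realType) (M L : R) :
  0 < M -> 0 < L ->
  competitive_ratio_le (aobd (delta_tilde M L)) [set s | admissible M L s]
    ((M + 2 * L + 6) / 4 + root_term M L / 4).
Proof.
move=> M0 L0 s adm /=; set c := _ + _; set delta := delta_tilde M L.
have disc0 : 0 <= (M + 2 * L - 2) ^+ 2 + 8 * (M + 4 * L + 4).
  by rewrite addr_ge0 ?sqr_ge0 //; lra.
have rootE := sqr_sqrtr disc0; rewrite -/(root_term M L) in rootE.
have root0 : 0 <= root_term M L := sqrtr_ge0 _.
(* This gives [1 + delta + L <= c] with slack [M / 2]. *)
have cE : c = 1 + delta + L + M / 2.
  by rewrite /c /delta /delta_tilde; field.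
(* With [cE], this quadratic equation makes [(c - 1) * delta] equal to [c + 1 + L]. *)
have deltaE : 2 * delta ^+ 2 + (M + 2 * L - 2) * delta = M + 4 * L + 4.
  rewrite /delta /delta_tilde; lra.
have delta0 : 0 < delta.
  rewrite /delta /delta_tilde -mulrBl divr_gt0 // subr_gt0.
  by nra.
have c0 : 0 < c by rewrite cE; lra.
rewrite -ler_pdivrMl //; apply: opt_cost_ge; first exact: adm.1.
move=> p feas; rewrite ler_pdivrMl //.
apply: (@aobd_cost_le _ delta L c delta0 _ _ M) => //; rewrite cE.
- by lra.
- by nra.
- by rewrite -cE ltW.
Qed.

Theorem theorem3 (R : realType) :
  (forall M L : R, 0 < M -> 0 < L ->
     competitive_ratio_le (aobd (delta_tilde M L)) [set s | admissible M L s]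
       ((M + 2 * L + 6) / 4 + root_term M L / 4)) /\
  (exists C K : R, forall M L : R, 0 < M -> 0 < L -> K <= M + L ->
     competitive_ratio_le (aobd (delta_tilde M L)) [set s | admissible M L s]
       (C * (M + L))).
Proof.
split=> [M L|]; first exact: competitive_ratio_delta_tilde.
(* Since [root_term M L <= M + 2 * L + 6], the ratio is at most [M / 2 + L + 3], and
   [3 <= 3 * (M + L)]. *)
exists 4, 1 => M L M0 L0 ML s adm.
apply: le_trans (competitive_ratio_delta_tilde M0 L0 adm) _.
apply: ler_wpM2r; first exact: opt_cost_ge0 adm.
have : root_term M L <= M + 2 * L + 6.
  rewrite /root_term -[leRHS]ger0_norm; last by lra.
  by rewrite -sqrtr_sqr; apply: ler_wsqrtr; rewrite le_eqVlt; nra.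
lra.
Qed.
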